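(* Let $n \ge 2$ be an integer and let $X_1, \dots, X_n$ be independent random variables, each uniformly distributed on $[0,1]$. Regard $X_1,\dots,X_n$ as breaking points of the stick $[0,1]$, so that they partition $[0,1]$ into $n+1$ intervals $I_1, \dots, I_{n+1}$. Then the probability that the lengths of $I_1, \dots, I_{n+1}$ are valid side lengths of a polygon with $n+1$ sides, i.e. that for every $1 \le i \le n+1$ the length of $I_i$ is strictly less than the sum of the lengths of all $I_j$ with $j \ne i$, is equal to $$1 - \frac{n+1}{2^n}.$$
   Context: If $X_{(1)} \le \dots \le X_{(n)}$ denotes the increasing rearrangement of $X_1, \dots, X_n$, the intervals of the partition are $I_1 = [0, X_{(1)}]$, $I_i = [X_{(i-1)}, X_{(i)}]$ for $1 < i \le n$, and $I_{n+1} = [X_{(n)}, 1]$. The length of an interval $[a,b]$ is $b-a$. No ordering of $X_1,\dots,X_n$ is assumed. *)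

(* Defs.v *)
From mathcomp Require Import all_boot all_order all_algebra.
From mathcomp Require Import all_classical all_reals all_analysis.

Set Implicit Arguments.
Unset Strict Implicit.
Unset Printing Implicit Defensive.

Import Order.TTheory GRing.Theory Num.Theory.

Local Open Scope classical_set_scope.
Local Open Scope ring_scope.

(* Mutual independence: the product rule for every subfamily J, so that it is
   stronger than pairwise independence. *)
Definition independent_RVs (d : measure_display) (T : measurableType d)
    (R : realType) (P : probability T R) (I : finType)
    (X : I -> {RV P >-> R}) : Prop :=
  forall (J : {set I}) (A : I -> set R),
    (forall i, i \in J -> measurable (A i)) ->
    P (\bigcap_(i in [set` J]) (X i @^-1` A i)) =
    (\prod_(i in J) P (X i @^-1` A i))%E.

(* The law is only compared on measurable sets: a measure is a total function
   on [set R], with no meaning outside the sigma-algebra. *)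
Definition uniform01_RV (d : measure_display) (T : measurableType d)
    (R : realType) (P : probability T R) (X : {RV P >-> R}) : Prop :=
  forall A : set R, measurable A ->
    distribution P X A = uniform_prob (@ltr01 R) A.

Definition order_stats (R : realType) (n : nat) (x : 'I_n -> R) : seq R :=
  sort <=%R [seq x i | i <- enum 'I_n].

Definition stick_points (R : realType) (n : nat) (x : 'I_n -> R) : seq R :=
  0 :: rcons (order_stats x) 1.

(* Indices are shifted by one: piece [i : 'I_n.+1] is the interval I_(i+1),
   with endpoints [(stick_points x)`_i] and [(stick_points x)`_i.+1]. *)
Definition piece_length (R : realType) (n : nat) (x : 'I_n -> R)
    (i : 'I_n.+1) : R :=
  (stick_points x)`_i.+1 - (stick_points x)`_i.

Definition polygon_sides (R : realType) (m : nat) (l : 'I_m -> R) : Prop :=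
  forall i : 'I_m, l i < \sum_(j < m | j != i) l j.

(* Main.v *)
Require Import Defs.
From mathcomp Require Import all_boot all_order all_algebra.
From mathcomp Require Import all_classical all_reals all_analysis.
From mathcomp Require Import ring lra.

(* Since the lengths add up to 1, the polygon exists iff no piece has length at
   least 1/2. The leftmost piece is that long iff all X_j >= 1/2, an event of
   probability 2^-n. The piece starting at X_k is that long iff X_k <= 1/2 and no
   other X_j lies in ]X_k, X_k + 1/2[: given X_k this has probability
   2^-(n-1), hence 2^-n in total. These n + 1 events are almost surely disjoint,
   so some piece is long with probability (n + 1) / 2^n.

   Conditioning on X_k is replaced by a partition of [0, 1/2] into cells of
   length h: on the cell [m h, (m + 1) h[, requiring the other points to avoid
   [m h, (m + 1) h + 1/2] (resp. ](m + 1) h, m h + 1/2[) gives events inside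
   (resp. covering) the long-piece event, whose probabilities are products by
   independence. The inner events are exactly disjoint, so letting h tend to 0
   also makes a separate treatment of ties unnecessary. *)

Import Order.TTheory GRing.Theory Num.Theory.
Import numFieldNormedType.Exports.

Local Open Scope classical_set_scope.
Local Open Scope ring_scope.

(** * Polygon inequalities and pieces of length at least 1/2 *)

Lemma sum_piece_length (R : realType) (n : nat) (x : 'I_n -> R) :
  \sum_(i < n.+1) piece_length x i = 1.
Proof.
rewrite /piece_length.
rewrite -(big_mkord xpredT
  (fun i => (stick_points x)`_i.+1 - (stick_points x)`_i)).
rewrite telescope_sumr// /stick_points /= subr0 nth_rcons.
by rewrite /order_stats size_sort size_map size_enum_ord ltnn eqxx.
Qed.

Lemma polygon_sides_piece_lengthP (R : realType) (n : nat) (x : 'I_n -> R) :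
  polygon_sides (piece_length x) <-> forall i, piece_length x i < 2^-1.
Proof.
have E i : (piece_length x i < \sum_(j < n.+1 | j != i) piece_length x j) =
    (piece_length x i < 2^-1).
  have := sum_piece_length _ _ x; rewrite (bigD1 i)//=.
  by move: (piece_length x i) (\sum_(_ < _ | _) _) => a b ab; apply/idP/idP; lra.
by split=> H i; move: (H i); rewrite E.
Qed.

(** * Long pieces in terms of the unsorted points *)

Section order_statistics.
Variables (R : realType) (n : nat) (x : 'I_n -> R).
Let s := order_stats x.

Lemma size_order_stats : size s = n.
Proof. by rewrite /s /order_stats size_sort size_map size_enum_ord. Qed.

Lemma order_stats_nthP (k : 'I_n) : exists i : 'I_n, x k = s`_i.
Proof.
have : x k \in s by rewrite /s mem_sort map_f// mem_enum.
move=> /(nthP 0)[i]; rewrite size_order_stats => ilt <-.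
by exists (Ordinal ilt).
Qed.

Lemma nth_order_statsP i : (i < n)%N -> exists k, s`_i = x k.
Proof.
move=> ilt; have : s`_i \in s by rewrite mem_nth// size_order_stats.
by rewrite /s mem_sort => /mapP[k _ ->]; exists k.
Qed.

Lemma le_order_stats i j : (i <= j)%N -> (j < n)%N -> s`_i <= s`_j.
Proof.
move=> ij jn; apply: (sorted_leq_nth le_trans le_refl) => //.
- exact/sort_sorted/le_total.
- by rewrite inE size_order_stats (leq_ltn_trans ij).
- by rewrite inE size_order_stats.
Qed.

Lemma piece_length0 : (0 < n)%N -> piece_length x ord0 = s`_0.
Proof.
move=> n0; rewrite /piece_length /stick_points /= subr0 nth_rcons.
by rewrite size_order_stats n0.
Qed.

Lemma piece_lengthS i (ilt : (i.+1 < n.+1)%N) :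
  piece_length x (Ordinal ilt) = (if (i.+1 < n)%N then s`_i.+1 else 1) - s`_i.
Proof.
have iltn : (i < n)%N by rewrite -ltnS.
rewrite /piece_length /stick_points /= !nth_rcons size_order_stats iltn.
by case: ifPn => //; rewrite -leqNgt => ni; rewrite eqn_leq iltn ni.
Qed.

(* A long piece starts at [0] or at the rightmost copy of some breaking point
   [x k]. Its right end is [1] only if no [x j] exceeds [x k]; as [x] is not
   assumed to lie in [0, 1], [x k <= 2^-1] is required in that case only. *)
Lemma long_pieceP : (0 < n)%N ->
  (exists i, 2^-1 <= piece_length x i) <->
  (forall j, 2^-1 <= x j) \/
  exists k, (forall j, x j <= x k \/ x k + 2^-1 <= x j) /\
            ((exists j, x k + 2^-1 <= x j) \/ x k <= 2^-1).
Proof.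
move=> n0; split=> [[[[|i] ilt]]|].
- rewrite (_ : Ordinal _ = ord0); last exact: val_inj.
  rewrite piece_length0// => s0.
  left=> j; have [m ->] := order_stats_nthP j.
  by apply: (le_trans s0); apply: le_order_stats.
- have iltn : (i < n)%N by rewrite -ltnS.
  rewrite piece_lengthS => h; right.
  have [k sk] := nth_order_statsP i iltn; exists k; move: h.
  case: ifP => [i1|i1n] h.
    split; last first.
      by left; have [j sj] := nth_order_statsP _ i1; exists j; lra.
    move=> j; have [m ->] := order_stats_nthP j; rewrite -sk.
    have [mi|im] := leqP m i; [left|right]; first exact: le_order_stats.
    by have := le_order_stats _ _ im (ltn_ord m); lra.
  have ein : i.+1 = n by apply/eqP; rewrite eqn_leq iltn leqNgt i1n.
  rewrite sk in h; split; last by right; lra.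
  move=> j; have [m ->] := order_stats_nthP j; left; rewrite -sk.
  by apply: le_order_stats => //; rewrite -ltnS ein.
case=> [h|[k [hk hk1]]].
  exists ord0; rewrite piece_length0//.
  by have [k ->] := nth_order_statsP 0 n0; exact: h.
have [i0 xki0] := order_stats_nthP k.
have Pi0 : s`_i0 <= x k by rewrite xki0.
(* The largest such [i] is the rank of the rightmost copy of [x k]: the next order statistic, if
   any, exceeds [x k], hence is at least [x k + 2^-1]. *)
case: (@arg_maxnP _ i0 (fun i : 'I_n => s`_i <= x k) (@nat_of_ord n) Pi0)
  => i si imax.
have sik : s`_i = x k.
  apply/eqP; rewrite eq_le si xki0; apply: le_order_stats => //.
  exact: imax.
have i1lt : (i.+1 < n.+1)%N by rewrite ltnS.
exists (Ordinal i1lt); rewrite piece_lengthS sik.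
case: ifP => [i1n|i1n].
  have [j sj] := nth_order_statsP _ i1n.
  case: (hk j) => [xj|]; last by rewrite sj; lra.
  have := imax (Ordinal i1n); rewrite sj => /(_ xj).
  by rewrite /= ltnn.
have ein : i.+1 = n by apply/eqP; rewrite eqn_leq ltn_ord leqNgt i1n.
(* Here [x k] is the maximum, so no [x j] lies 1/2 beyond it and the piece runs from [x k] to 1. *)
case: hk1 => [[j xj]|]; last by lra.
exfalso; have [m xm] := order_stats_nthP j.
have /(_ _)/= := le_order_stats m i; rewrite -ltnS ein ltn_ord => /(_ isT (leqnn n)).
by rewrite -xm sik; lra.
Qed.

End order_statistics.

(** * Uniform probabilities of intervals and the product rule *)

(** The density is 1 on a subinterval of [0, 1]. The flags [b0] and [b1] cover open, closed and
    half-open intervals at once. *)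
Lemma uniform01_RV_itv (d : measure_display) (T : measurableType d)
    (R : realType) (P : probability T R) (X : {RV P >-> R})
    (b0 b1 : bool) (a b : R) :
  uniform01_RV X -> 0 <= a -> a <= b -> b <= 1 ->
  P (X @^-1` [set` Interval (BSide b0 a) (BSide b1 b)]) = (b - a)%:E.
Proof.
move=> unifX a0 ab b1'; set I := [set` _].
have mI : measurable I by exact: measurable_itv.
have -> : P (X @^-1` I) = distribution P X I by [].
rewrite unifX// /uniform_prob.
rewrite (eq_integral (cst 1%E)); last first.
  move=> x; rewrite inE /I /= itv_boundlr => /andP[ax xb].
  rewrite /uniform_pdf subr0 invr1 ifT//; apply/andP; split.
    rewrite (le_trans a0)//.
    by case: b0 ax {I mI} => //=; rewrite bnd_simp// => /ltW.
  rewrite (le_trans _ b1')//.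
  by case: b1 xb {I mI} => //=; rewrite bnd_simp// => /ltW.
rewrite integral_cst// mul1e /I /= lebesgue_measure_itv /= lte_fin.
(* The formula for the Lebesgue measure splits on [a < b]; what remains is [a = b], of length 0. *)
case: ifPn => [//|]; rewrite -leNgt => ba.
by rewrite (_ : b = a) ?subrr//; apply/eqP; rewrite eq_le ba ab.
Qed.

Lemma uniform01_RV_itvC (d : measure_display) (T : measurableType d)
    (R : realType) (P : probability T R) (X : {RV P >-> R})
    (b0 b1 : bool) (a b : R) :
  uniform01_RV X -> 0 <= a -> a <= b -> b <= 1 ->
  P (X @^-1` (~` [set` Interval (BSide b0 a) (BSide b1 b)])) = (1 - (b - a))%:E.
Proof.
move=> unifX a0 ab b1'; set I := [set` _].
have mI : measurable I by exact: measurable_itv.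
have mXI : measurable (X @^-1` I) by exact: measurable_funPTI.
by rewrite preimage_setC probability_setC// uniform01_RV_itv.
Qed.

Lemma independent_RVs_prod (d : measure_display) (T : measurableType d)
    (R : realType) (P : probability T R) (n : nat) (X : 'I_n -> {RV P >-> R})
    (A : 'I_n -> set R) (p : 'I_n -> R) :
  independent_RVs X -> (forall i, measurable (A i)) ->
  (forall i, P (X i @^-1` A i) = (p i)%:E) ->
  P [set w | forall i, A i (X i w)] = (\prod_i p i)%:E.
Proof.
move=> indX mA pA.
rewrite (_ : [set _ | _] = \bigcap_(i in [set` [set: 'I_n]%SET]) (X i @^-1` A i)).
  rewrite (indX _ _ (fun i _ => mA i)) -prodEFin.
  by apply: eq_big => [i|i _]; rewrite ?inE.
by apply/seteqP; split=> w /= h i // *; apply: h => /=; rewrite inE.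
Qed.

(** * Finite unions and measurability *)

Section finite_unions.
Context (d : measure_display) (T : measurableType d) (R : realType).
Variables (mu : {measure set T -> \bar R}) (I : choiceType) (F : I -> set T).
Hypothesis mF : forall i, measurable (F i).

Lemma measure_bigsetU_le (r : seq I) :
  (mu (\big[setU/set0]_(i <- r) F i) <= \sum_(i <- r) mu (F i))%E.
Proof.
elim: r => [|i r ih]; first by rewrite !big_nil measure0.
rewrite !big_cons; apply: (le_trans (measureU2 _ _ _)) => //.
  exact: bigsetU_measurable.
exact: leeD.
Qed.

Lemma measure_bigsetU_disj (r : seq I) : uniq r ->
  (forall i j w, F i w -> F j w -> i = j) ->
  mu (\big[setU/set0]_(i <- r) F i) = (\sum_(i <- r) mu (F i))%E.
Proof.
move=> + disj; elim: r => [_|i r ih]; first by rewrite !big_nil measure0.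
rewrite cons_uniq => /andP[ir ur]; rewrite !big_cons measureU//.
    by congr (_ + _)%E; exact: ih.
  exact: bigsetU_measurable.
rewrite -subset0 => w [Fi]; rewrite -bigcup_seq => -[j /= jr Fj].
by rewrite (disj _ _ _ Fi Fj) jr in ir.
Qed.

End finite_unions.

Lemma measurable_forall (d : measure_display) (T : measurableType d)
    (I : finType) (F : I -> set T) :
  (forall i, measurable (F i)) -> measurable [set w | forall i, F i w].
Proof.
move=> mF; rewrite (_ : [set _ | _] = \bigcap_(i in setT) F i).
  by apply: fin_bigcap_measurable => //; exact: finite_finset.
by apply/seteqP; split=> w /= h i => [_|]; exact: h.
Qed.

Lemma measurable_exists (d : measure_display) (T : measurableType d)
    (I : finType) (F : I -> set T) :
  (forall i, measurable (F i)) -> measurable [set w | exists i, F i w].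
Proof.
move=> mF; rewrite (_ : [set _ | _] = \bigcup_(i in setT) F i).
  by apply: fin_bigcup_measurable => //; exact: finite_finset.
by apply/seteqP; split=> w /= [i] => [|_] Fi; exists i.
Qed.

Lemma measurable_set_le (d : measure_display) (T : measurableType d)
    (R : realType) (f g : T -> R) :
  measurable_fun setT f -> measurable_fun setT g ->
  measurable [set w | f w <= g w].
Proof.
by move=> mf mg; rewrite -[X in measurable X]setTI; exact: measurable_fun_le.
Qed.

(** * The long-piece event and its grid approximations *)

Section broken_stick.
Context (d : measure_display) (T : measurableType d) (R : realType).
Variables (P : probability T R) (n : nat) (X : 'I_n -> {RV P >-> R}).
Hypothesis n_gt0 : (0 < n)%N.
Hypothesis X_indep : independent_RVs X.
Hypothesis X_unif : forall i : 'I_n, uniform01_RV (X i).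

Definition long_piece : set T :=
  [set w | exists i, 2^-1 <= piece_length (fun j => X j w) i].

Let long_pieceE w := long_pieceP R n (fun j => X j w) n_gt0.

(** [long_pieceP] describes the event by finitely many comparisons between the variables, which
    bypasses the measurability of sorting. *)
Lemma measurable_long_piece : measurable long_piece.
Proof.
rewrite (_ : long_piece = [set w | forall j, 2^-1 <= X j w] `|`
  [set w | exists k, ([set w | forall j, ([set w | X j w <= X k w] `|`
                                 [set w | X k w + 2^-1 <= X j w]) w] `&`
      ([set w | exists j, X k w + 2^-1 <= X j w] `|`
       [set w | X k w <= 2^-1])) w]); last first.
  by apply/seteqP; split=> w /= /long_pieceE.
have mX j : measurable_fun setT (X j) by exact: measurable_funPT.
have mX2 j : measurable_fun setT (fun w => X j w + 2^-1).
  by apply: measurable_realfun.measurable_funD.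
apply: measurableU.
  by apply: measurable_forall => j; exact: measurable_set_le.
apply: measurable_exists => k; apply: measurableI.
  by apply: measurable_forall => j; apply: measurableU; exact: measurable_set_le.
apply: measurableU; last exact: measurable_set_le.
by apply: measurable_exists => j; exact: measurable_set_le.
Qed.

(** Product rule with [A] at index [k] and [B] at the [n.-1] others; it takes the place of
    conditioning on [X k]. *)
Lemma independent_RVs_one_vs_rest (k : 'I_n) (A B : set R) (a b : R) :
  measurable A -> measurable B ->
  P (X k @^-1` A) = a%:E -> (forall j, P (X j @^-1` B) = b%:E) ->
  P [set w | A (X k w) /\ forall j, j != k -> B (X j w)] =
  (a * b ^+ n.-1)%:E.
Proof.
move=> mA mB Aa Bb.
rewrite (_ : [set _ | _] =
    [set w | forall i, (if i == k then A else B) (X i w)]); last first.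
  apply/seteqP; split=> w /=.
    by move=> [Ak Bj] i; case: (eqVneq i k) => [->//|]; exact: Bj.
  move=> h; split=> [|j /negbTE jk]; first by have := h k; rewrite eqxx.
  by have := h j; rewrite jk.
rewrite (independent_RVs_prod _ _ _ _ _ X (fun i => if i == k then A else B)
  (fun i => if i == k then a else b))//.
- rewrite (bigD1 k)//= eqxx; congr (a * _)%:E.
  under eq_bigr => i /negbTE -> do [].
  rewrite prodr_const; congr (_ ^+ _).
  by have := cardC1 k; rewrite card_ord => <-.
- by move=> i; case: ifP.
- by move=> i; case: eqP => [->|].
Qed.

(** Half-open, so that distinct cells are disjoint. *)
Definition cell (h : R) (m : nat) : set R := `[m%:R * h, m.+1%:R * h[%classic.

(* [None] stands for "the leftmost piece is long", [Some (k, m)] for "the piece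
   starting at X_k is long and X_k lies in the m-th cell of the grid of mesh h";
   [B m] approximates the complement of ]X_k, X_k + 1/2[ on that cell. *)
Definition approx_event (h : R) (B : nat -> set R) (N : nat)
    (o : option ('I_n * 'I_N)) : set T :=
  if o is Some (k, m) then
    [set w | cell h m (X k w) /\ forall j, j != k -> B m (X j w)]
  else [set w | forall j, X j w \in `[2^-1, 1]].

Definition approx_index (N : nat) : seq (option ('I_n * 'I_N)) :=
  None :: [seq Some p | p <- enum {: 'I_n * 'I_N}].

Lemma mem_approx_index N o : o \in approx_index N.
Proof.
case: o => [p|]; rewrite inE//=; apply/map_f; exact: mem_enum.
Qed.

Lemma uniq_approx_index N : uniq (approx_index N).
Proof.
rewrite /= map_inj_uniq ?enum_uniq ?andbT; last by move=> ? ? [].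
by apply/mapP => -[].
Qed.

Lemma measurable_approx_event h B N o :
  (forall m, measurable (B m)) -> measurable (approx_event h B N o).
Proof.
move=> mB; case: o => [[k m]|] /=.
  apply: (@measurableI _ _ (X k @^-1` cell h m)).
    by apply: measurable_funPTI; exact: measurable_itv.
  apply: measurable_forall => j; case: (j != k) => /=; last first.
    by rewrite (_ : (fun _ => _) = setT)//; apply/seteqP; split.
  rewrite (_ : (fun _ => _) = X j @^-1` B m); first exact: measurable_funPTI.
  by apply/seteqP; split=> w /=; [exact|].
apply: measurable_forall => j.
suff : measurable (X j @^-1` `[2^-1, 1]%classic) by [].
by apply: measurable_funPTI; exact: measurable_itv.
Qed.

(** [None] contributes [2^-1 ^+ n], and each of the [n * N] pairs contributes [h * b ^+ n.-1]. The
    bound on [N%:R * h] keeps the cells inside [0, 1], where each has probability [h]. *)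
Lemma sum_approx_event h B N b : 0 <= h -> N%:R * h <= 1 ->
  (forall m, measurable (B m)) ->
  (forall m j, (m < N)%N -> P (X j @^-1` B m) = b%:E) ->
  (\sum_(o <- approx_index N) P (approx_event h B N o))%E =
  (2^-1 ^+ n + n%:R * (N%:R * h) * b ^+ n.-1)%:E.
Proof.
move=> h0 Nh mB Bb; rewrite /approx_index big_cons big_map big_enum /=.
rewrite (independent_RVs_prod _ _ _ _ _ X (fun=> `[2^-1, 1]%classic) (fun=> 2^-1))//.
- rewrite prodr_const card_ord.
  rewrite (eq_bigr (fun=> (h * b ^+ n.-1)%:E)) => [|[k m] _].
    rewrite sumEFin sumr_const -EFinD; congr (_ + _)%:E.
    by rewrite card_prod !card_ord -[LHS]mulr_natl natrM !mulrA.
  apply: independent_RVs_one_vs_rest => //.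
  + exact: measurable_itv.
  + rewrite (uniform01_RV_itv _ _ _ _ _ _ _ _ _ (X_unif k)).
    * by rewrite -mulrBl -natrB// subSnn mul1r.
    * by rewrite mulr_ge0.
    * by rewrite ler_wpM2r// ler_nat.
    * by rewrite (le_trans _ Nh)// ler_wpM2r// ler_nat.
  + by move=> j; apply: Bb.
- by move=> i; rewrite uniform01_RV_itv//; [congr _%:E|..]; lra.
Qed.

(** With this mesh, [N.+1] cells exactly fill [0, 1/2[. The interval removed on a cell has length
    [2^-1 + h] and contains [X_k, X_k + 1/2] for every X_k in that cell, so the approximating events
    lie inside [long_piece]. *)
Lemma long_piece_ge (N : nat) (h := (2 * N.+1%:R)^-1 : R) :
  ((2^-1 ^+ n + n%:R * 2^-1 * (2^-1 - h) ^+ n.-1)%:E <= P long_piece)%E.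
Proof.
have h0 : 0 < h by rewrite invr_gt0 mulr_gt0.
have Nh : N.+1%:R * h = 2^-1 by rewrite /h; field.
clearbody h.
pose B m : set R := ~` `[m%:R * h, m.+1%:R * h + 2^-1]%classic.
have mB m : measurable (B m) by apply: measurableC; exact: measurable_itv.
have mh (m : nat) : 0 <= m%:R * h by rewrite mulr_ge0// ltW.
have Sh (m : nat) : m.+1%:R * h = m%:R * h + h by rewrite -natr1 mulrDl mul1r.
have mN m : (m < N.+1)%N -> m.+1%:R * h <= 2^-1.
  by move=> mN; rewrite -Nh ler_wpM2r ?ler_nat// ltW.
have PB m j : (m < N.+1)%N -> P (X j @^-1` B m) = (2^-1 - h)%:E.
  move=> /mN; have := mh m; have := Sh m => ? ? ?.
  by rewrite uniform01_RV_itvC//; [congr _%:E|..]; lra.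
have Nh1 : N.+1%:R * h <= 1 by rewrite Nh; lra.
rewrite -[X in n%:R * X]Nh -(sum_approx_event _ _ _ _ (ltW h0) Nh1 mB PB).
have disj : forall o o' w,
    approx_event h B N.+1 o w -> approx_event h B N.+1 o' w -> o = o'.
  case=> [[k m]|] [[k' m']|] w //=.
  - move=> [Ak Bk] [Ak' Bk'].
    have {}kk' : k = k'.
      (* Both points are below 1/2, so [X k'] can avoid the interval removed around [X k] only by
         lying to its left, and vice versa: each would be smaller than the other. *)
      apply/eqP/negPn/negP => kk'.
      have := Bk k'; rewrite eq_sym => /(_ kk').
      have := Bk' k => /(_ kk').
      move: Ak Ak'; rewrite /B /cell /= !in_itv/=.
      have := mN _ (ltn_ord m); have := mN _ (ltn_ord m').
      have := Sh m; have := Sh m'; have := mh m; have := mh m'.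
      move=> ? ? ? ? ? ? /andP[? ?] /andP[? ?] /negP + /negP.
      rewrite !negb_and -!ltNge => /orP[?|?] /orP[?|?]; lra.
    subst k'; congr (Some (_, _)); apply/val_inj => /=.
    move: Ak Ak'; rewrite /cell /= !in_itv/= => /andP[a1 a2] /andP[a3 a4].
    have lt_cell (i j : nat) : i%:R * h < j.+1%:R * h -> (i <= j)%N.
      by rewrite ltr_pM2r// ltr_nat ltnS.
    apply/eqP; rewrite eqn_leq; apply/andP; split; apply: lt_cell.
      exact: le_lt_trans a4.
    exact: le_lt_trans a2.
  (* A point in a cell is strictly below 1/2, whereas [None] requires all points to be at least
     1/2. *)
  - rewrite /cell /= in_itv/= => -[/andP[? ?] _] /(_ k); rewrite in_itv/=.
    have := mN _ (ltn_ord m) => ? /andP[? ?]; exfalso; lra.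
  - move=> /(_ k'); rewrite /cell /= !in_itv/= => /andP[? ?] [/andP[? ?] _].
    have := mN _ (ltn_ord m') => ?; exfalso; lra.
have mA := measurable_approx_event h B N.+1 ^~ mB.
rewrite -(measure_bigsetU_disj _ _ _ _ _ _ mA)//; last exact: uniq_approx_index.
apply: le_measure; rewrite ?inE.
- by apply: bigsetU_measurable => o _; exact: measurable_approx_event.
- exact: measurable_long_piece.
move=> w; rewrite -bigcup_seq => -[[[k m]|] _ /= hw]; apply/long_pieceE.
  right; exists k; case: hw; rewrite /cell /= in_itv/= => /andP[mk km] hj.
  have := mN _ (ltn_ord m); have := Sh m => ? ?.
  split; last by right; lra.
  move=> j; have [->|jk] := eqVneq j k; first by left.
  have /negP := hj j jk; rewrite /= in_itv/= negb_and -!ltNge => /orP[?|?].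
    by left; lra.
  by right; lra.
by left=> j; have := hw j; rewrite in_itv/= => /andP[].
Qed.

(** The open interval removed on a cell has length [2^-1 - h] and lies inside ]X_k, X_k + 1/2[. One
    cell more than in the lower bound is taken, since X_k may equal 1/2. *)
Lemma long_piece_le (N : nat) (h := (2 * N.+1%:R)^-1 : R) :
  (P long_piece <= (2^-1 ^+ n + n%:R * (2^-1 + h) ^+ n)%:E)%E.
Proof.
have h0 : 0 < h by rewrite invr_gt0 mulr_gt0.
have Nh : N.+1%:R * h = 2^-1 by rewrite /h; field.
clearbody h.
have h2 : h <= 2^-1 by rewrite -Nh ler_peMl// ?ler1n// ltW.
pose B m : set R := ~` `]m.+1%:R * h, m%:R * h + 2^-1[%classic.
have mB m : measurable (B m) by apply: measurableC; exact: measurable_itv.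
have mh (m : nat) : 0 <= m%:R * h by rewrite mulr_ge0// ltW.
have Sh (m : nat) : m.+1%:R * h = m%:R * h + h by rewrite -natr1 mulrDl mul1r.
have mN m : (m < N.+2)%N -> m%:R * h <= 2^-1.
  by move=> mN; rewrite -Nh ler_wpM2r ?ler_nat// ltW.
(* The variables lie in [0, 1] only almost surely; these null events absorb the exceptions. *)
pose E j : set T := X j @^-1` (~` `[0, 1]%classic).
have mE j : measurable (E j).
  by apply: measurable_funPTI; apply: measurableC; exact: measurable_itv.
have PE : P (\big[setU/set0]_(j <- enum 'I_n) E j) = 0%E.
  apply/eqP; rewrite eq_le measure_ge0 andbT.
  apply: (le_trans (measure_bigsetU_le _ _ _ _ _ _ mE _)).
  rewrite big1// => j _.
  have := uniform01_RV_itvC _ _ _ _ (X j) true false 0 1 (X_unif j).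
  by rewrite subr0 subrr; exact.
(* One factor [2^-1 + h] is the total length of the [N.+2] cells; the other [n.-1] come from the
   remaining points. *)
rewrite -[n in X in (_ <= (_ + _ * X)%:E)%E](prednK n_gt0) exprS mulrA.
have PB m j : (m < N.+2)%N -> P (X j @^-1` B m) = (2^-1 + h)%:E.
  move=> /mN; have := mh m; have := Sh m => ? ? ?.
  by rewrite uniform01_RV_itvC//; [congr _%:E|..]; lra.
have Nh1 : N.+2%:R * h <= 1 by rewrite Sh Nh; lra.
rewrite -[X in n%:R * (X + _)]Nh -Sh.
rewrite -(sum_approx_event _ _ _ _ (ltW h0) Nh1 mB PB).
have mA := measurable_approx_event h B N.+2 ^~ mB.
rewrite -[leRHS]add0e -[X in (_ <= X + _)%E]PE.
apply: (@le_trans _ _ (P (\big[setU/set0]_(j <- enum 'I_n) E j `|`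
  \big[setU/set0]_(o <- approx_index N.+2) approx_event h B N.+2 o))).
  apply: le_measure; rewrite ?inE.
  - exact: measurable_long_piece.
  - by apply: measurableU; apply: bigsetU_measurable => o _.
  move=> w /= /long_pieceE hw.
  have [[j Ej]|nE] := pselect (exists j, E j w).
    by left; rewrite -bigcup_seq; exists j => //=; rewrite mem_enum.
  right; rewrite -bigcup_seq.
  have X01 j : 0 <= X j w <= 1.
    rewrite -[_ && _]negbK; apply/negP => Xj; apply: nE; exists j.
    by rewrite /E /= in_itv/=; apply/negP.
  case: hw => [hw|[k [hk hk1]]].
    exists None; first exact: mem_approx_index.
    by move=> j /=; rewrite in_itv/= hw; case/andP: (X01 j).
  (* If some [X j] is at least [X k + 2^-1], this follows from [X j <= 1]. *)
  have Xk2 : X k w <= 2^-1.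
    by case: hk1 => // -[j]; have /andP[_] := X01 j; lra.
  have /andP[Xk0 _] := X01 k.
  (* The cell containing [X k w] has as index the integer part of [X k w / h]. *)
  have /truncn_itv /andP[] : 0 <= X k w / h by rewrite divr_ge0// ltW.
  rewrite ler_pdivlMr// ltr_pdivrMr//; set m := Num.truncn _ => mX Xm.
  have mlt : (m < N.+2)%N.
    by rewrite ltnS -(ler_nat R) -(ler_pM2r h0) Nh (le_trans mX).
  exists (Some (k, Ordinal mlt)); first exact: mem_approx_index.
  split=> [|j jk]; first by rewrite /cell /= in_itv/= mX.
  rewrite /B /= in_itv/= => /andP[? ?].
  by case: (hk j); lra.
apply: (le_trans (measureU2 _ _ _)).
- by apply: bigsetU_measurable => o _.
- by apply: bigsetU_measurable => o _.
by rewrite leeD2l//; exact: measure_bigsetU_le.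
Qed.

(** * Limit as the mesh tends to 0, and the complementary event *)

Lemma prob_long_piece : P long_piece = (n.+1%:R / 2 ^+ n)%:E.
Proof.
have fP : P long_piece \is a fin_num.
  exact: fin_num_measure measurable_long_piece.
rewrite -(fineK fP); congr _%:E.
have hcvg : (fun N => (2 * N.+1%:R)^-1 : R) @ \oo --> (0 : R).
  rewrite (_ : (fun _ => _) = (fun N => 2^-1 * harmonic N)).
    by rewrite -(mulr0 2^-1); apply: cvgM; [exact: cvg_cst|exact: cvg_harmonic].
  by apply/funext => N; rewrite /harmonic/= invfM.
(* Common form of both bounds: [a = n] and [k = n] for the upper one, [a = n / 2] and [k = n.-1] for
   the lower one. The two limits coincide. *)
have pcvg (a : R) (k : nat) (u : nat -> R) : u @ \oo --> (2^-1 : R) ->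
    (fun N => 2^-1 ^+ n + a * u N ^+ k) @ \oo -->
    (2^-1 ^+ n + a * 2^-1 ^+ k : R).
  move=> ucvg; apply: cvgD; first exact: cvg_cst.
  apply: cvgM; first exact: cvg_cst.
  apply: (@continuous_cvg _ _ _ _ _ u (fun x : R => x ^+ k)) => //.
  exact: exprn_continuous.
have lE : n.+1%:R / 2 ^+ n = 2^-1 ^+ n + n%:R * 2^-1 ^+ n :> R.
  by rewrite exprVn -[n.+1]add1n natrD mulrDl mul1r.
apply/eqP; rewrite eq_le lE; apply/andP; split.
  have /(pcvg n%:R n) : (fun N => 2^-1 + (2 * N.+1%:R)^-1) @ \oo --> (2^-1 : R).
    by rewrite -[X in _ --> X]addr0; apply: cvgD => //; exact: cvg_cst.
  move=> /cvgr_to_ge; apply; apply: nearW => N.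
  by rewrite -lee_fin fineK//; exact: long_piece_le.
have -> : n%:R * 2^-1 ^+ n = n%:R * 2^-1 * 2^-1 ^+ n.-1 :> R.
  by rewrite -mulrA -exprS prednK.
have /(pcvg (n%:R * 2^-1) n.-1) : (fun N => 2^-1 - (2 * N.+1%:R)^-1) @ \oo --> (2^-1 : R).
  by rewrite -[X in _ --> X]subr0; apply: cvgB => //; exact: cvg_cst.
move=> /cvgr_to_le; apply; apply: nearW => N.
by rewrite -lee_fin fineK//; exact: long_piece_ge.
Qed.

End broken_stick.

Theorem mainTheorem1 (d : measure_display) (T : measurableType d)
    (R : realType) (P : probability T R) (n : nat) (hn : (2 <= n)%N)
    (X : 'I_n -> {RV P >-> R})
    (X_indep : independent_RVs X)
    (X_unif : forall i : 'I_n, uniform01_RV (X i)) :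
  P [set w : T | polygon_sides (piece_length (fun i : 'I_n => X i w))] =
  (1 - n.+1%:R / 2 ^+ n)%:E.
Proof.
have n0 : (0 < n)%N by exact: leq_trans hn.
rewrite (_ : [set _ | _] = ~` long_piece _ _ _ P n X).
  rewrite probability_setC; last exact: measurable_long_piece.
  by rewrite prob_long_piece.
apply/seteqP; split=> w /=.
  by move=> /polygon_sides_piece_lengthP short [i]; rewrite leNgt short.
move=> nlong; apply/polygon_sides_piece_lengthP => i.
by rewrite ltNge; apply/negP => ?; apply: nlong; exists i.
Qed.
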